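(* Let $\xi\in\mathbb{R}^p$, $M\in\mathbb{R}^{p\times k}$, and let $\mathcal{S}=\{s\in\mathbb{R}^p: A_{\mathcal{S}}s\le b_{\mathcal{S}}\}$ be a polytope containing the origin, where $A_{\mathcal{S}}\in\mathbb{R}^{m\times p}$ has rows $a_{1,\mathcal S},\dots,a_{m,\mathcal S}$ and $b_{\mathcal{S}}\in\mathbb{R}^m$. (i) (Case $q=1$.) Let $\bar{\mathcal{S}}:=\{z\in\mathbb{R}^k: A_{\mathcal S}Mz\le b_{\mathcal S}-A_{\mathcal S}\xi\}$ and define $r\in\mathbb{R}^k$ by letting, for $j\in\{1,\dots,k\}$, with $e_j\in\mathbb{R}^k$ the $j$-th unit vector, $$r_j=r_j(\bar{\mathcal S}):=\max_{z\in\mathbb{R}^k,\ \omega\in\mathbb{R}}\ \omega\quad\text{s.t.}\quad A_{\mathcal S}Mz\le b_{\mathcal S}-A_{\mathcal S}\xi,\ \ A_{\mathcal S}M(z+\omega e_j)\le b_{\mathcal S}-A_{\mathcal S}\xi,\ \ z+\omega e_j\ge0,\ \ z\le0.$$ Then a maximum-volume (${\rm vol}_1$) $r$-constrained hyper-rectangle $\mathcal{B}(l,u)\subset\mathbb{R}^k$ that contains the origin and satisfies $\xi\in\mathcal{S}\ominus M\mathcal{B}(l,u)$ is $\mathcal{B}(z^*,z^*+\lambda^*r)$, where $z^*\in\mathbb{R}^k$ and $\lambda^*\in\mathbb{R}$ form an optimal solution of the linear program $$\max_{z,\lambda}\ \lambda\quad\text{s.t.}\quad A_{\mathcal S}Mz+(A_{\mathcal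 S}M)^+r\lambda\le b_{\mathcal S}-A_{\mathcal S}\xi,\quad z+\lambda r\ge0,\quad z\le0.$$ (ii) (Case $q=2$.) For $i\in\{1,\dots,m\}$ let $\hat w^i:=\mathrm{sign}(M^\top a_{i,\mathcal S}^\top)$ (entrywise) and let $w^i\in\mathbb{R}^{2k}$ be given, for $j\in\{1,\dots,k\}$, by $w^i_j=(M^\top a_{i,\mathcal S}^\top)_j$ if $\hat w^i_j=1$ and $w^i_j=0$ otherwise, and $w^i_{k+j}=-(M^\top a_{i,\mathcal S}^\top)_j$ if $\hat w^i_j=-1$ and $w^i_{k+j}=0$ otherwise. Put $$W=(w^1,\dots,w^m)^\top\in\mathbb{R}^{m\times 2k},\quad W'=\begin{pmatrix}W\\ -I_{2k}\end{pmatrix},\quad B=b_{\mathcal S}-A_{\mathcal S}\xi,\quad B'=\begin{pmatrix}B\\ 0_{2k\times1}\end{pmatrix}.$$ Define $r\in\mathbb{R}^{2k}$ by letting, for $j\in\{1,\dots,2k\}$, with $e_j\in\mathbb{R}^{2k}$ the $j$-th unit vector, $r_j:=\max_{\omega\in\mathbb{R}}\{\omega: W'(\omega e_j)\le B'\}$, and split it as $r=(\overline r^{\top},\underline r^{\top})^\top$ with $\overline r,\underline r\in\mathbb{R}^k$. Then a maximum-volume (${\rm vol}_2$) $r$-constrained hyper-rectangle $\mathcal{B}(l,u)\subset\mathbb{R}^k$ that contains the origin and satisfies $\xi\in\mathcal{S}\ominus M\mathcal{B}(l,u)$ is $\mathcal{B}(-\lambda^*\underline r,\lambda^*\overline r)$,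 where $\lambda^*\in\mathbb{R}$ is the optimal solution of the linear program $$\max_{\lambda}\ \lambda\quad\text{s.t.}\quad W^+r\lambda\le B.$$
   Context: Vector inequalities are componentwise. A polytope is a bounded polyhedron. For $l,u\in\mathbb{R}^k$, $\mathcal{B}(l,u):=\{x\in\mathbb{R}^k: l\le x\le u\}$ (full-dimensional when $l<u$). For a matrix $G$, $G^+$ is the matrix with entries $G^+_{ij}=\max\{0,G_{ij}\}$. For a set $\mathcal{B}\subset\mathbb{R}^k$, $M\mathcal{B}:=\{Mz:z\in\mathcal{B}\}$; $\mathcal{C}\ominus\mathcal{D}:=\{c:c+d\in\mathcal{C}\ \forall d\in\mathcal{D}\}$ is the Pontryagin difference. For a hyper-rectangle containing the origin, written $\mathcal{B}(-\underline v,\overline v)$ with $\underline v,\overline v\ge0$: $${\rm vol}_1:=\prod_{j=1}^k(\overline v_j+\underline v_j),\qquad {\rm vol}_2:=\prod_{j=1}^k\overline v_j\,\underline v_j .$$ ''$r$-constrained'' means that the edge lengths are fixed up to a common scaling factor. In case (i), with $r\in\mathbb{R}^k$, an $r$-constrained hyper-rectangle is one of the form $\mathcal{B}(z,z+\lambda r)$ with $z\in\mathbb{R}^k$, $\lambda\ge0$. In case (ii), with $r=(\overline r^\top,\underline r^\top)^\top\in\mathbb{R}^{2k}$, it is one of the form $\mathcal{B}(-\lambda\underline r,\lambda\overline r)$ with $\lambda\ge0$. *)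

(* Defs.v *)
From HB Require Import structures.
From mathcomp Require Import all_boot all_order all_algebra.
From mathcomp Require Import all_classical all_reals all_analysis.

Set Implicit Arguments.
Unset Strict Implicit.
Unset Printing Implicit Defensive.

Import Order.TTheory GRing.Theory Num.Theory.
Import numFieldNormedType.Exports.

Local Open Scope classical_set_scope.
Local Open Scope ring_scope.

Definition lev (R : realType) (n : nat) (x y : 'cV[R]_n) : Prop :=
  forall i, x i 0 <= y i 0.
Notation "x <=v y" := (lev x y) (at level 70, no associativity) : ring_scope.

Definition polyhedron (R : realType) (m n : nat) (A : 'M[R]_(m, n))
  (b : 'cV[R]_m) : set 'cV[R]_n := [set x | A *m x <=v b].

Definition polytope (R : realType) (m n : nat) (A : 'M[R]_(m, n))
  (b : 'cV[R]_m) : Prop := bounded_set (polyhedron A b).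

Definition pos_mx (R : realType) (m n : nat) (G : 'M[R]_(m, n)) : 'M[R]_(m, n) :=
  \matrix_(i, j) Num.max 0 (G i j).

Definition pontryagin_diff (R : realType) (n : nat) (C D : set 'cV[R]_n) :
  set 'cV[R]_n := [set c | forall d, D d -> C (c + d)].

Definition box (R : realType) (k : nat) (l u : 'cV[R]_k) : set 'cV[R]_k :=
  [set x | l <=v x /\ x <=v u].

(* The volumes of B(- vl, vu), for vl, vu >= 0. *)
Definition vol1 (R : realType) (k : nat) (vl vu : 'cV[R]_k) : R :=
  \prod_(j < k) (vu j 0 + vl j 0).

Definition vol2 (R : realType) (k : nat) (vl vu : 'cV[R]_k) : R :=
  \prod_(j < k) (vu j 0 * vl j 0).

Definition maximizer (R : realType) (T : Type) (F : set T) (f : T -> R) (x : T) :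
  Prop := F x /\ forall y, F y -> f y <= f x.

Definition max_value (R : realType) (T : Type) (F : set T) (f : T -> R) (v : R) :
  Prop := exists2 x, maximizer F f x & f x = v.

(* A hyper-rectangle B(l, u) is represented by the pair (l, u); this pair is
   determined by B(l, u) as soon as the latter is nonempty. *)
Definition admissible (R : realType) (p k : nat) (S : set 'cV[R]_p)
  (M : 'M[R]_(p, k)) (xi : 'cV[R]_p) (H : 'cV[R]_k * 'cV[R]_k) : Prop :=
  box H.1 H.2 0 /\ pontryagin_diff S [set M *m z | z in box H.1 H.2] xi.

Definition r_constrained1 (R : realType) (k : nat) (r : 'cV[R]_k)
  (H : 'cV[R]_k * 'cV[R]_k) : Prop :=
  exists z : 'cV[R]_k, exists2 lam : R, 0 <= lam & H = (z, z + lam *: r).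

(* Here r stacks the upper lengths on top of the lower ones. *)
Definition r_constrained2 (R : realType) (k : nat) (r : 'cV[R]_(k + k))
  (H : 'cV[R]_k * 'cV[R]_k) : Prop :=
  exists2 lam : R, 0 <= lam & H = (- (lam *: dsubmx r), lam *: usubmx r).

Definition Sbar (R : realType) (m p k : nat) (AS : 'M[R]_(m, p)) (bS : 'cV[R]_m)
  (M : 'M[R]_(p, k)) (xi : 'cV[R]_p) : set 'cV[R]_k :=
  polyhedron (AS *m M) (bS - AS *m xi).

(* Pairs (z, omega). *)
Definition edge_feasible1 (R : realType) (k : nat) (Sb : set 'cV[R]_k)
  (j : 'I_k) : set ('cV[R]_k * R) :=
  [set zw | [/\ Sb zw.1, Sb (zw.1 + zw.2 *: delta_mx j 0),
                0 <=v zw.1 + zw.2 *: delta_mx j 0 & zw.1 <=v 0]].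

(* Pairs (z, lambda). *)
Definition lp_feasible1 (R : realType) (m p k : nat) (AS : 'M[R]_(m, p))
  (bS : 'cV[R]_m) (M : 'M[R]_(p, k)) (xi : 'cV[R]_p) (r : 'cV[R]_k) :
  set ('cV[R]_k * R) :=
  [set zl | [/\ AS *m M *m zl.1 + zl.2 *: (pos_mx (AS *m M) *m r)
                  <=v bS - AS *m xi,
                0 <=v zl.1 + zl.2 *: r & zl.1 <=v 0]].

Definition w_hat (R : realType) (m p k : nat) (AS : 'M[R]_(m, p))
  (M : 'M[R]_(p, k)) (i : 'I_m) : 'cV[R]_k :=
  map_mx Num.sg (M^T *m (row i AS)^T).

Definition w_vec (R : realType) (m p k : nat) (AS : 'M[R]_(m, p))
  (M : 'M[R]_(p, k)) (i : 'I_m) : 'cV[R]_(k + k) :=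
  col_mx
    (\col_j if w_hat AS M i j 0 == 1 then (M^T *m (row i AS)^T) j 0 else 0)
    (\col_j if w_hat AS M i j 0 == -1 then - (M^T *m (row i AS)^T) j 0 else 0).

Definition W_mx (R : realType) (m p k : nat) (AS : 'M[R]_(m, p))
  (M : 'M[R]_(p, k)) : 'M[R]_(m, k + k) :=
  \matrix_(i, j) w_vec AS M i j 0.

Definition W'_mx (R : realType) (m p k : nat) (AS : 'M[R]_(m, p))
  (M : 'M[R]_(p, k)) : 'M[R]_(m + (k + k), k + k) :=
  col_mx (W_mx AS M) (- 1%:M).

Definition B_vec (R : realType) (m p : nat) (AS : 'M[R]_(m, p)) (bS : 'cV[R]_m)
  (xi : 'cV[R]_p) : 'cV[R]_m := bS - AS *m xi.

Definition B'_vec (R : realType) (m p : nat) (k : nat) (AS : 'M[R]_(m, p))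
  (bS : 'cV[R]_m) (xi : 'cV[R]_p) : 'cV[R]_(m + (k + k)) :=
  col_mx (B_vec AS bS xi) 0.

Definition edge_feasible2 (R : realType) (m p k : nat) (AS : 'M[R]_(m, p))
  (bS : 'cV[R]_m) (M : 'M[R]_(p, k)) (xi : 'cV[R]_p) (j : 'I_(k + k)) : set R :=
  [set w | W'_mx AS M *m (w *: delta_mx j 0) <=v B'_vec k AS bS xi].

Definition lp_feasible2 (R : realType) (m p k : nat) (AS : 'M[R]_(m, p))
  (bS : 'cV[R]_m) (M : 'M[R]_(p, k)) (xi : 'cV[R]_p) (r : 'cV[R]_(k + k)) :
  set R :=
  [set lam | lam *: (pos_mx (W_mx AS M) *m r) <=v B_vec AS bS xi].

(* Main.v *)
Require Import Defs.
From mathcomp Require Import all_boot all_order all_algebra.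
From mathcomp Require Import all_classical all_reals all_analysis.
From mathcomp Require Import lra.
Set Implicit Arguments.
Unset Strict Implicit.
Unset Printing Implicit Defensive.

Import Order.TTheory GRing.Theory Num.Theory.
Import numFieldNormedType.Exports.
Local Open Scope classical_set_scope.
Local Open Scope ring_scope.

(** Put [G = AS *m M] and [B = bS - AS *m xi].  The point [xi] lies in the
    Pontryagin difference of [S] and [M] times a box iff [G *m x <=v B] for every
    [x] of the box.  Each row of [G] is a linear form, and its maximum over a
    nonempty box [l, u] is attained at the vertex taking [u] where the coefficient
    is nonnegative and [l] elsewhere; so the robust constraint amounts to the
    single vector inequality
    [pos_mx G *m u - pos_mx (- G) *m l <=v B] ([admissible_boxE]).

    Since [G = pos_mx G - pos_mx (- G)], for the box [z, z + lam *: r] the left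
    side is [G *m z + lam *: (pos_mx G *m r)], the constraint of the first
    program.  The matrix [W] is the row of blocks [pos_mx G], [pos_mx (- G)]
    ([W_mxE]), so that for the second family of boxes the left side is
    [lam *: (W *m r)], the constraint of the second program.  As soon as [r] is
    nonnegative, the feasible points of the program with [0 <= lam] are thus
    exactly the admissible boxes of the family, and the volume of such a box is a
    product of factors [lam * r_j], hence nondecreasing in [lam]: maximizing
    [lam] maximizes the volume.

    The programs that define [r] supply two facts.  Their constraints
    force [0 <=v r].  Feasibility for a single [j] also forces [0 <=v B]
    (in the first case because the origin lies on a segment with endpoints in the
    convex set [Sbar]), so that [lam = 0] is feasible and the optimal [lam] is
    nonnegative.  If [k = 0] there is no [j], but then every [lam] is feasible as
    soon as one is, and no optimal solution exists. *)

(** * Support of a box *)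

Lemma lev0P (R : realType) (n : nat) (x : 'cV[R]_n) :
  (0 <=v x) <-> (forall i, 0 <= x i 0).
Proof. by split=> x0 i; have := x0 i; rewrite !mxE. Qed.

Section BoxSupport.
Context {R : realType}.

Lemma pos_mx_ge0 (m n : nat) (G : 'M[R]_(m, n)) i j : 0 <= pos_mx G i j.
Proof. by rewrite mxE le_max lexx. Qed.

Lemma pos_mx_id (m n : nat) (G : 'M[R]_(m, n)) :
  (forall i j, 0 <= G i j) -> pos_mx G = G.
Proof. by move=> G0; apply/matrixP => i j; rewrite mxE; apply/max_idPr. Qed.

Lemma pos_mxBN (m n : nat) (G : 'M[R]_(m, n)) : pos_mx G - pos_mx (- G) = G.
Proof.
apply/matrixP => i j; rewrite !mxE.
have [G0|G0] := leP 0 (G i j).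
- by rewrite max_l ?subr0 // oppr_le0.
- by rewrite max_r ?opprK ?add0r // oppr_ge0 ltW.
Qed.

(** If [l <=v u], row [i] is the maximum over [box l u] of row [i] of [G], as a form
    in [x] (the support function of the box). *)
Definition box_support (m n : nat) (G : 'M[R]_(m, n)) (l u : 'cV[R]_n) :
  'cV[R]_m := pos_mx G *m u - pos_mx (- G) *m l.

Lemma box_supportE (m n : nat) (G : 'M[R]_(m, n)) (l u : 'cV[R]_n) i :
  box_support G l u i 0 =
  \sum_j (if 0 <= G i j then G i j * u j 0 else G i j * l j 0).
Proof.
rewrite !mxE -sumrB; apply: eq_bigr => j _; rewrite !mxE.
have [G0|G0] := leP 0 (G i j).
- by rewrite max_l ?mul0r ?subr0 // oppr_le0.
- by rewrite max_r ?mulNr ?opprK ?mul0r ?add0r // oppr_ge0 ltW.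
Qed.

(** The bound is attained row by row, each row at its own vertex of the box. *)
Lemma box_support_le (m n : nat) (G : 'M[R]_(m, n)) (l u : 'cV[R]_n)
    (B : 'cV[R]_m) : l <=v u ->
  (forall x, box l u x -> G *m x <=v B) <-> box_support G l u <=v B.
Proof.
move=> lu; split=> [GB i|HB x [lx xu] i].
- pose v : 'cV[R]_n := \col_j if 0 <= G i j then u j 0 else l j 0.
  have vbox : box l u v.
    by split=> j; rewrite mxE; case: ifP => // _; exact: lu.
  rewrite (le_trans _ (GB v vbox i))// box_supportE mxE.
  by apply: ler_sum => j _; rewrite mxE; case: ifP.
- rewrite (le_trans _ (HB i))// box_supportE mxE.
  apply: ler_sum => j _; case: (leP 0 (G i j)) => G0.
  + exact: ler_wpM2l (xu j).
  + exact: ler_wnM2l (ltW G0) _ _ (lx j).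
Qed.

Lemma box_support_shift (m n : nat) (G : 'M[R]_(m, n)) (z r : 'cV[R]_n)
    (lam : R) :
  box_support G z (z + lam *: r) = G *m z + lam *: (pos_mx G *m r).
Proof.
by rewrite /box_support mulmxDr -scalemxAr addrAC -mulmxBl pos_mxBN.
Qed.

Lemma box_support_around0 (m n : nat) (G : 'M[R]_(m, n)) (r : 'cV[R]_(n + n))
    (lam : R) :
  box_support G (- (lam *: dsubmx r)) (lam *: usubmx r)
  = lam *: (row_mx (pos_mx G) (pos_mx (- G)) *m r).
Proof.
rewrite /box_support mulmxN opprK -!scalemxAr -scalerDr.
by rewrite -{3}[r]vsubmxK mul_row_col.
Qed.

End BoxSupport.

(** * Admissible boxes and the two linear programs *)

Lemma lev_subRL (R : realType) (n : nat) (x y b : 'cV[R]_n) :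
  (y <=v b - x) <-> (x + y <=v b).
Proof. by split=> H i; have := H i; rewrite !mxE lerBrDl. Qed.

Section Admissible.
Context {R : realType} {p k m : nat}.
Variables (xi : 'cV[R]_p) (M : 'M[R]_(p, k)) (AS : 'M[R]_(m, p)).
Variable bS : 'cV[R]_m.

Lemma polyhedron_translateE (x : 'cV[R]_k) :
  polyhedron AS bS (xi + M *m x) <-> AS *m M *m x <=v bS - AS *m xi.
Proof.
by rewrite /polyhedron /= mulmxDr mulmxA lev_subRL.
Qed.

Lemma admissible_boxE (l u : 'cV[R]_k) : l <=v u ->
  admissible (polyhedron AS bS) M xi (l, u) <->
  [/\ l <=v 0, 0 <=v u & box_support (AS *m M) l u <=v bS - AS *m xi].
Proof.
move=> lu; split.
- move=> [[/= l0 u0] adm]; split=> //; apply/box_support_le => // x lux.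
  by apply/polyhedron_translateE; apply: adm; exists x.
- move=> [l0 u0 /(box_support_le _ _ lu) sup]; split=> // _ [x lux <-].
  by apply/polyhedron_translateE; exact: sup.
Qed.

Lemma admissible_shiftE (r z : 'cV[R]_k) (lam : R) : 0 <=v r -> 0 <= lam ->
  admissible (polyhedron AS bS) M xi (z, z + lam *: r) <->
  lp_feasible1 AS bS M xi r (z, lam).
Proof.
move=> r0 lam0.
have lu : z <=v z + lam *: r.
  by move=> j; rewrite !mxE lerDl mulr_ge0//; move/lev0P: r0.
rewrite admissible_boxE// box_support_shift.
by split=> -[? ? ?]; split.
Qed.

(** The sign tests that define [W] select the positive and the negative parts of
    the entries of [AS *m M]. *)
Lemma W_mxE : W_mx AS M = row_mx (pos_mx (AS *m M)) (pos_mx (- (AS *m M))).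
Proof.
have GE i j : (M^T *m (row i AS)^T) j 0 = (AS *m M) i j.
  by rewrite -trmx_mul mxE -row_mul mxE.
apply/matrixP => i j; rewrite mxE /w_vec -[j]fintype.splitK.
case: (fintype.split j) => j' /=.
- rewrite col_mxEu row_mxEl mxE /w_hat [map_mx _ _ _ _]mxE GE [RHS]mxE.
  by rewrite sgr_cp0 maxElt.
- rewrite col_mxEd row_mxEr mxE /w_hat [map_mx _ _ _ _]mxE GE [RHS]mxE.
  by rewrite [(- (AS *m M)) i j']mxE sgr_cp0 maxElt oppr_gt0.
Qed.

Lemma W_mx_ge0 i j : 0 <= W_mx AS M i j.
Proof.
by rewrite W_mxE -[j]fintype.splitK; case: (fintype.split j) => j' /=;
  rewrite ?row_mxEl ?row_mxEr pos_mx_ge0.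
Qed.

Lemma admissible_around0E (r : 'cV[R]_(k + k)) (lam : R) :
  0 <=v r -> 0 <= lam ->
  admissible (polyhedron AS bS) M xi
    (- (lam *: dsubmx r), lam *: usubmx r) <->
  lp_feasible2 AS bS M xi r lam.
Proof.
move=> r0 lam0; have /lev0P r_ge0 := r0.
have l0 : - (lam *: dsubmx r) <=v 0.
  by move=> j; rewrite !mxE oppr_le0 mulr_ge0.
have u0 : 0 <=v lam *: usubmx r.
  by move=> j; rewrite !mxE mulr_ge0.
have lu : - (lam *: dsubmx r) <=v lam *: usubmx r.
  by move=> j; exact: le_trans (l0 j) (u0 j).
rewrite admissible_boxE// box_support_around0 -W_mxE /lp_feasible2 /=.
by rewrite (pos_mx_id W_mx_ge0); split=> [[]//|?]; split.
Qed.

(** * What the edge-length programs give *)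

Lemma edge_feasible1_ge0 j z w :
  edge_feasible1 (Sbar AS bS M xi) j (z, w) -> 0 <= w.
Proof. by move=> [_ _ /(_ j) + /(_ j)] /=; rewrite !mxE !eqxx mulr1 /=; lra. Qed.

(** A feasible [z] has support in coordinate [j], so [0] is on the segment from
    [z] to [z + w *: delta_mx j 0]; rowwise, a linear form that is at most [B] at
    both ends is at most [B] at [0]. *)
Lemma edge_feasible1_origin j z w :
  edge_feasible1 (Sbar AS bS M xi) j (z, w) -> 0 <=v bS - AS *m xi.
Proof.
move=> [/= Sz Szw zw0 z0]; apply/lev0P => i.
have zE : z = z j 0 *: delta_mx j 0.
  apply/colP => a; rewrite !mxE eqxx andbT.
  have [->|aj] := eqVneq a j; first by rewrite mulr1.
  move: (zw0 a) (z0 a); rewrite !mxE (negbTE aj) /= !mulr0 addr0.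
  by move=> ? ?; apply: le_anti; apply/andP.
have zwE : z + w *: delta_mx j 0 = (z j 0 + w) *: delta_mx j 0.
  by rewrite {1}zE -scalerDl.
have tw0 : 0 <= z j 0 + w.
  by have := zw0 j; rewrite zwE !mxE !eqxx mulr1.
have t0 : z j 0 <= 0 by have := z0 j; rewrite [leRHS]mxE.
have scaleE c (v : 'cV[R]_m) : (c *: v) i 0 = c * v i 0 by rewrite mxE.
have := Sz i; have := Szw i.
rewrite zwE {2}zE -!scalemxAr !scaleE.
move: ((AS *m M *m delta_mx j 0) i 0) (z j 0) tw0 t0 => g t tw0 t0.
case: (leP 0 g) => g0 H1 H2.
- exact: le_trans (mulr_ge0 tw0 g0) H1.
- exact: le_trans (mulr_le0 t0 (ltW g0)) H2.
Qed.

Lemma edge_feasible2_ge0 j w : edge_feasible2 AS bS M xi j w -> 0 <= w.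
Proof.
move=> /(_ (rshift m j)).
rewrite /W'_mx /B'_vec mul_col_mx !col_mxEd mulNmx mul1mx !mxE !eqxx mulr1.
by rewrite oppr_le0.
Qed.

Lemma edge_feasible2_origin j w :
  edge_feasible2 AS bS M xi j w -> 0 <=v B_vec AS bS xi.
Proof.
move=> wE; apply/lev0P => i; move: (wE (lshift (k + k) i)).
rewrite /W'_mx /B'_vec mul_col_mx !col_mxEu -scalemxAr -colE mxE.
rewrite [col _ _ _ _]mxE; apply: le_trans.
exact: mulr_ge0 (edge_feasible2_ge0 wE) (W_mx_ge0 i j).
Qed.

End Admissible.

(** * Volumes along a family *)

Lemma vol1_shift (R : realType) (k : nat) (z r : 'cV[R]_k) (lam : R) :
  vol1 (- z) (z + lam *: r) = \prod_(j < k) (lam * r j 0).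
Proof. by apply: eq_bigr => j _; rewrite !mxE addrAC subrr add0r. Qed.

Lemma vol2_around0 (R : realType) (k : nat) (r : 'cV[R]_(k + k)) (lam : R) :
  vol2 (- - (lam *: dsubmx r)) (lam *: usubmx r)
  = \prod_(j < k) ((lam * usubmx r j 0) * (lam * dsubmx r j 0)).
Proof. by apply: eq_bigr => j _; rewrite opprK !mxE. Qed.

Theorem theorem4p5 (R : realType) (p k m : nat) (xi : 'cV[R]_p)
  (M : 'M[R]_(p, k)) (AS : 'M[R]_(m, p)) (bS : 'cV[R]_m)
  (hS : polytope AS bS) (hS0 : polyhedron AS bS 0) :
  (forall r : 'cV[R]_k,
     (forall j : 'I_k,
        max_value (edge_feasible1 (Sbar AS bS M xi) j) snd (r j 0)) ->
     forall (zstar : 'cV[R]_k) (lstar : R),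
       maximizer (lp_feasible1 AS bS M xi r) snd (zstar, lstar) ->
       maximizer
         [set H | r_constrained1 r H /\ admissible (polyhedron AS bS) M xi H]
         (fun H => vol1 (- H.1) H.2)
         (zstar, zstar + lstar *: r))
  /\
  (forall r : 'cV[R]_(k + k),
     (forall j : 'I_(k + k),
        max_value (edge_feasible2 AS bS M xi j) id (r j 0)) ->
     forall lstar : R,
       maximizer (lp_feasible2 AS bS M xi r) id lstar ->
       maximizer
         [set H | r_constrained2 r H /\ admissible (polyhedron AS bS) M xi H]
         (fun H => vol2 (- H.1) H.2)
         (- (lstar *: dsubmx r), lstar *: usubmx r)).
Proof.
split=> r rmax.
- move=> zs ls [feas opt].
  have r_ge0 j : 0 <= r j 0.
    by have [[z w] [/edge_feasible1_ge0 + _] /= <-] := rmax j.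
  have r0 : 0 <=v r by apply/lev0P.
  have ls0 : 0 <= ls.
    case: k M r rmax zs feas opt r_ge0 r0 => [|k'] M r rmax zs feas opt _ _.
      (* With no coordinate, [ls + 1] is feasible as well. *)
      have r_eq0 : r = 0 by apply/colP => -[].
      have /opt /= : lp_feasible1 AS bS M xi r (zs, ls + 1).
        by move: feas; rewrite r_eq0 /lp_feasible1 /= mulmx0 !scaler0.
      lra.
    have [[z w] [/edge_feasible1_origin B0 _] _] := rmax ord0.
    apply: (opt (0, 0)).
    by split; rewrite /= ?mulmx0 ?scale0r ?addr0.
  split=> [|_ [[z [lam lam0 ->]] adm]] /=.
    by split; [exists zs; exists ls|apply/admissible_shiftE].
  rewrite !vol1_shift.
  have /opt /= lam_le : lp_feasible1 AS bS M xi r (z, lam).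
    exact/admissible_shiftE.
  by apply: ler_prod => j _; rewrite mulr_ge0//= ler_wpM2r.
- move=> ls [feas opt].
  have r_ge0 j : 0 <= r j 0.
    by have [w [/edge_feasible2_ge0 + _] /= <-] := rmax j.
  have r0 : 0 <=v r by apply/lev0P.
  have ls0 : 0 <= ls.
    case: k M r rmax feas opt r_ge0 r0 => [|k'] M r rmax feas opt _ _.
      have r_eq0 : r = 0 by apply/colP => -[].
      have /opt /= : lp_feasible2 AS bS M xi r (ls + 1).
        by move: feas; rewrite r_eq0 /lp_feasible2 /= mulmx0 !scaler0.
      lra.
    have [w [/edge_feasible2_origin B0 _] _] := rmax ord0.
    by apply: (opt 0); rewrite /lp_feasible2 /= scale0r.
  split=> [|_ [[lam lam0 ->] adm]] /=.
    by split; [exists ls|apply/admissible_around0E].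
  rewrite !vol2_around0.
  have /opt /= lam_le : lp_feasible2 AS bS M xi r lam.
    exact/admissible_around0E.
  apply: ler_prod => j _; rewrite ![usubmx _ _ _]mxE ![dsubmx _ _ _]mxE.
  by rewrite !mulr_ge0//= ler_pM ?mulr_ge0 ?ler_wpM2r.
Qed.
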